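(* Let $\varepsilon_1,\varepsilon_2$ be positive real numbers and let $\mathcal{P}=[0,\varepsilon_1]\times[0,\varepsilon_2]$ be the algebra of lifetimes, ordered by $(a_1,a_2)\le(b_1,b_2)$ iff $b_1\le a_1$ and $a_2\le b_2$. Then $\mathcal{P}$, together with the operations defined for any family $\{a_i\}_{i\in I}$ of elements $a_i=(a_{1i},a_{2i})\in\mathcal{P}$ by $$\bigwedge_{i\in I} a_i=\Bigl(\bigvee_{i\in I}a_{1i},\ \bigwedge_{i\in I}a_{2i}\Bigr)\quad\text{and}\quad \bigvee_{i\in I} a_i=\Bigl(\bigwedge_{i\in I}a_{1i},\ \bigvee_{i\in I}a_{2i}\Bigr),$$ is a complete lattice satisfying the infinite distributive law $$x\wedge\bigvee_{i\in I}y_i=\bigvee_{i\in I}(x\wedge y_i)$$ for all $x\in\mathcal{P}$ and any family $\{y_i\}_{i\in I}$ of elements of $\mathcal{P}$. Hence $\mathcal{P}$ is a complete Heyting algebra.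
   Context: On the right-hand sides of the definitions, $\bigvee$ and $\bigwedge$ of real numbers denote the supremum and infimum taken in the complete chains $[0,\varepsilon_1]$ (first coordinate) and $[0,\varepsilon_2]$ (second coordinate) with their usual order. The algebra of lifetimes $\mathcal{P}$ is the set of pairs $(a_1,a_2)$ with $0\le a_1\le\varepsilon_1$ and $0\le a_2\le\varepsilon_2$ (no condition $a_1\le a_2$ is imposed), with binary operations $a\wedge b=(\max(a_1,b_1),\min(a_2,b_2))$ and $a\vee b=(\min(a_1,b_1),\max(a_2,b_2))$; equivalently, $\mathcal{P}=[0,\varepsilon_1]^{op}\times[0,\varepsilon_2]$ with the product order. A Heyting algebra is a bounded lattice $L$ such that for all $a,b\in L$ there is a greatest $x\in L$ with $a\wedge x\le b$; a complete Heyting algebra is a Heyting algebra that is a complete lattice. *)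

(* Defs.v *)
From HB Require Import structures.
From mathcomp Require Import all_boot all_order all_algebra interval_inference.
From mathcomp Require Import all_classical all_reals.

Set Implicit Arguments.
Unset Strict Implicit.
Unset Printing Implicit Defensive.

Import Order.TTheory GRing.Theory Num.Theory.
Local Open Scope ring_scope.
Local Open Scope classical_set_scope.
Local Open Scope order_scope.

Section Complete.
Context {d : Order.disp_t}.

Definition complete_lattice (L : porderType d) : Prop :=
  forall A : set L, supremums A !=set0 /\ infimums A !=set0.

Definition heyting_algebra (L : tbLatticeType d) : Prop :=
  forall a b : L, exists x : L,
    a `&` x <= b /\ forall y : L, a `&` y <= b -> y <= x.

Definition complete_heyting_algebra (L : tbLatticeType d) : Prop :=
  heyting_algebra L /\ complete_lattice L.

End Complete.

Section Chain.
Context {R : realType}.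
Implicit Type e : {posnum R}.

Definition chain e : Type := {x : R | (0 <= x <= e%:num)%R}.

HB.instance Definition _ e := SubChoice.on (chain e).
HB.instance Definition _ e :=
  [SubChoice_isSubOrder of chain e by <: with ring_display].

Fact chain_bot_subproof e : (0 <= (0 : R) <= e%:num)%R.
Proof. by rewrite lexx ge0. Qed.

Fact chain_top_subproof e : (0 <= e%:num <= e%:num)%R.
Proof. by rewrite lexx ge0. Qed.

Definition chain_bot e : chain e := exist _ 0%R (chain_bot_subproof e).
Definition chain_top e : chain e := exist _ e%:num%R (chain_top_subproof e).

Fact chain_le0x e (x : chain e) : chain_bot e <= x.
Proof. by rewrite leEsub /=; case/andP: (valP x). Qed.

Fact chain_lex1 e (x : chain e) : x <= chain_top e.
Proof. by rewrite leEsub /=; case/andP: (valP x). Qed.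

HB.instance Definition _ e :=
  Order.hasBottom.Build ring_display (chain e) (@chain_le0x e).
HB.instance Definition _ e :=
  Order.hasTop.Build ring_display (chain e) (@chain_lex1 e).

(* [supremum] and [infimum] take as first argument their value on the
   empty set; in the chain [0, e] these are its least, resp. greatest, element,
   so that the bounds of the empty family are the ones of the chain. *)
Definition chain_sup e {I : Type} (f : I -> chain e) : chain e :=
  supremum \bot (range f).
Definition chain_inf e {I : Type} (f : I -> chain e) : chain e :=
  infimum \top (range f).

End Chain.

Fact lifetime_display : Order.disp_t. Proof. exact: (Order.Disp tt tt). Qed.

Section Lifetime.
Context {R : realType}.
Implicit Type e : {posnum R}.

Definition lifetime e1 e2 : Type := (chain e1 * chain e2)%type.

HB.instance Definition _ e1 e2 := Choice.on (lifetime e1 e2).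

Section Order.
Context {e1 e2 : {posnum R}}.
Implicit Types a b c : lifetime e1 e2.

Definition lifetime_le a b : bool := (b.1 <= a.1) && (a.2 <= b.2).

Definition lifetime_meet a b : lifetime e1 e2 :=
  (Order.max a.1 b.1, Order.min a.2 b.2).
Definition lifetime_join a b : lifetime e1 e2 :=
  (Order.min a.1 b.1, Order.max a.2 b.2).

Definition lifetime_bot : lifetime e1 e2 := (\top, \bot).
Definition lifetime_top : lifetime e1 e2 := (\bot, \top).

Fact lifetime_le_refl : reflexive lifetime_le.
Proof. by move=> a; rewrite /lifetime_le !lexx. Qed.

Fact lifetime_le_anti : antisymmetric lifetime_le.
Proof.
move=> [a1 a2] [b1 b2] /andP[/andP[/= h1 h2] /andP[/= h3 h4]].
by congr pair; apply/le_anti/andP.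
Qed.

Fact lifetime_le_trans : transitive lifetime_le.
Proof.
move=> b a c /andP[h1 h2] /andP[h3 h4].
by rewrite /lifetime_le (le_trans h3 h1) (le_trans h2 h4).
Qed.

End Order.

HB.instance Definition _ e1 e2 :=
  Order.Le_isPOrder.Build lifetime_display (lifetime e1 e2)
    lifetime_le_refl lifetime_le_anti lifetime_le_trans.

Section Lattice.
Context {e1 e2 : {posnum R}}.
Implicit Types a b c : lifetime e1 e2.

Fact lifetime_meetP a b c : (a <= lifetime_meet b c) = (a <= b) && (a <= c).
Proof.
rewrite /Order.le/= /lifetime_le /= ge_max le_min.
by rewrite -!andbA; do !bool_congr.
Qed.

Fact lifetime_joinP a b c : (lifetime_join a b <= c) = (a <= c) && (b <= c).
Proof.
rewrite /Order.le/= /lifetime_le /= le_min ge_max.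
by rewrite -!andbA; do !bool_congr.
Qed.

Fact lifetime_le0x a : lifetime_bot <= a.
Proof. by apply/andP; split; [exact: lex1|exact: le0x]. Qed.

Fact lifetime_lex1 a : a <= lifetime_top.
Proof. by apply/andP; split; [exact: le0x|exact: lex1]. Qed.

End Lattice.

HB.instance Definition _ e1 e2 :=
  Order.POrder_MeetJoin_isLattice.Build lifetime_display (lifetime e1 e2)
    lifetime_meetP lifetime_joinP.
HB.instance Definition _ e1 e2 :=
  Order.hasBottom.Build lifetime_display (lifetime e1 e2) lifetime_le0x.
HB.instance Definition _ e1 e2 :=
  Order.hasTop.Build lifetime_display (lifetime e1 e2) lifetime_lex1.

Definition lifetime_inf e1 e2 {I : Type} (a : I -> lifetime e1 e2) :
    lifetime e1 e2 :=
  (chain_sup (fun i => (a i).1), chain_inf (fun i => (a i).2)).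
Definition lifetime_sup e1 e2 {I : Type} (a : I -> lifetime e1 e2) :
    lifetime e1 e2 :=
  (chain_inf (fun i => (a i).1), chain_sup (fun i => (a i).2)).

End Lifetime.

(* Main.v *)
Require Import Defs.
From mathcomp Require Import all_boot all_order all_algebra interval_inference.
From mathcomp Require Import all_classical all_reals.
Local Open Scope ring_scope.
Local Open Scope classical_set_scope.
Local Open Scope order_scope.
Import Order.TTheory GRing.Theory Num.Theory.

(** A lifetime is a pair of points of two chains, the first chain being
    reversed, so everything is computed coordinatewise.

    Completeness comes from the reals: a nonempty subset of [0, e] has a real
    supremum, which stays between 0 and e, and the empty subset has the
    supremum 0 ([chain_supremums_neq0]).  Infima then come for free, as suprema
    of sets of lower bounds ([supremums_lbound]).

    The infinite distributive law is an instance of the fact that left adjoints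
    preserve suprema.  In a chain, min(a, x) <= b says that x <= top when
    a <= b and that x <= b otherwise; using this in the second coordinate and
    its dual in the first one yields a residual [lifetime_imp a b], that is
    a /\ x <= b iff x <= lifetime_imp a b ([le_lifetime_imp]).  The residual is
    the Heyting implication, and its mere existence makes x /\ _ commute with
    suprema ([meet_supremums]). *)

Lemma supremums_lbound {d} {L : porderType d} (A : set L) :
  supremums (lbound A) `<=` infimums A.
Proof.
move=> s [ubs leasts]; split=> [x Ax|x]; last exact: ubs.
by apply: leasts => y; apply.
Qed.

(** The default value of [supremum] is returned on the empty set, where it has
    to be the bottom element for the result to be a supremum. *)
Lemma supremum_supremums {d} {T : bOrderType d} (A : set T) :
  supremums A !=set0 -> supremums A (supremum \bot A).
Proof.
rewrite /supremum => -[s As]; case: ifPn => [/eqP ->|_]; last exact: xgetI As.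
by split=> [x []|x _]; exact: le0x.
Qed.

Lemma infimum_infimums {d} {T : tOrderType d} (A : set T) :
  infimums A !=set0 -> infimums A (infimum \top A).
Proof.
rewrite /infimum => -[s As]; case: ifPn => [/eqP ->|_]; last exact: xgetI As.
by split=> [x []|x _]; exact: lex1.
Qed.

(** A residual of [x `&` _] turns any upper bound of the [x `&` y i] into an
    upper bound of the [y i]; the converse inequality is monotonicity. *)
Lemma meet_supremums {d} {L : latticeType d} (imp : L -> L -> L)
    (impP : forall a x b : L, (a `&` x <= b) = (x <= imp a b))
    (I : Type) (x : L) (y : I -> L) (s t : L) :
  supremums (range y) s -> supremums (range (fun i => x `&` y i)) t ->
  x `&` s = t.
Proof.
move=> [ubs leasts] [ubt leastt]; apply/le_anti/andP; split.
- rewrite impP; apply: leasts => _ [i _ <-].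
  by rewrite -impP; apply: ubt; exists i.
- apply: leastt => _ [i _ <-].
  by apply: leI2 => //; apply: ubs; exists i.
Qed.

Section ChainCompleteness.
Context {R : realType} {e : {posnum R}}.

Lemma chain_supremums_neq0 (A : set (chain e)) : supremums A !=set0.
Proof.
have [->|/set0P[x0 Ax0]] := eqVneq A set0.
  by exists \bot; split=> [x []|x _]; exact: le0x.
pose B : set R := [set val x | x in A].
have B0 : B !=set0 by exists (val x0), x0.
have ubB (y : R) : (forall x, A x -> val x <= y) -> ubound B y.
  by move=> leAy _ [x Ax <-]; exact: leAy.
have ubBe : ubound B e%:num by apply: ubB => x _; case/andP: (valP x).
have leB : ubound B (sup B) by apply: ub_le_sup; exists e%:num.
have sup_ge0 : 0%R <= sup B.
  apply: (@le_trans _ _ (val x0)); first by case/andP: (valP x0).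
  by apply: leB; exists x0.
have sup_in : (0%R <= sup B <= e%:num)%R by rewrite sup_ge0 ge_sup.
exists (exist _ (sup B) sup_in); split=> [x Ax|y uby]; rewrite -Order.le_val /=.
  by apply: leB; exists x.
by apply: ge_sup => //; apply: ubB => x Ax; rewrite Order.le_val; exact: uby.
Qed.

Lemma chain_infimums_neq0 (A : set (chain e)) : infimums A !=set0.
Proof.
by have [s /supremums_lbound As] := chain_supremums_neq0 (lbound A); exists s.
Qed.

Lemma chain_supP I (f : I -> chain e) : supremums (range f) (chain_sup f).
Proof. exact/supremum_supremums/chain_supremums_neq0. Qed.

Lemma chain_infP I (f : I -> chain e) : infimums (range f) (chain_inf f).
Proof. exact/infimum_infimums/chain_infimums_neq0. Qed.

End ChainCompleteness.

Section LifetimeCompleteness.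
Context {R : realType} {e1 e2 : {posnum R}}.
Implicit Types a b x : lifetime e1 e2.

Lemma le_lifetimeE a b : (a <= b) = (b.1 <= a.1) && (a.2 <= b.2).
Proof. by []. Qed.

Lemma lifetime_infP I (a : I -> lifetime e1 e2) :
  infimums (range a) (lifetime_inf a).
Proof.
have [ub1 least1] := chain_supP _ (fun i => (a i).1).
have [lb2 greatest2] := chain_infP _ (fun i => (a i).2).
split=> [_ [i _ <-]|b lbb]; rewrite le_lifetimeE; apply/andP; split.
- by apply: ub1; exists i.
- by apply: lb2; exists i.
- apply: least1 => _ [i _ <-].
  by have /andP[] : b <= a i by apply: lbb; exists i.
- apply: greatest2 => _ [i _ <-].
  by have /andP[] : b <= a i by apply: lbb; exists i.
Qed.

Lemma lifetime_supP I (a : I -> lifetime e1 e2) :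
  supremums (range a) (lifetime_sup a).
Proof.
have [lb1 greatest1] := chain_infP _ (fun i => (a i).1).
have [ub2 least2] := chain_supP _ (fun i => (a i).2).
split=> [_ [i _ <-]|b ubb]; rewrite le_lifetimeE; apply/andP; split.
- by apply: lb1; exists i.
- by apply: ub2; exists i.
- apply: greatest1 => _ [i _ <-].
  by have /andP[] : a i <= b by apply: ubb; exists i.
- apply: least2 => _ [i _ <-].
  by have /andP[] : a i <= b by apply: ubb; exists i.
Qed.

Lemma lifetime_complete : complete_lattice (lifetime e1 e2).
Proof.
(* A set is the range of the inclusion of its elements. *)
have rangeE (A : set (lifetime e1 e2)) : range (@sval _ A) = A.
  by apply/seteqP; split=> [_ [[x Ax] _ <-]//|x Ax]; exists (exist _ x Ax).
move=> A; rewrite -[A]rangeE; split.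
- by eexists; exact: lifetime_supP.
- by eexists; exact: lifetime_infP.
Qed.

(** The Gödel implication of the chain [0, e2], paired with its order dual
    on [0, e1]. *)
Definition lifetime_imp a b : lifetime e1 e2 :=
  (if b.1 <= a.1 then \bot else b.1, if a.2 <= b.2 then \top else b.2).

Lemma le_lifetime_imp a x b : (a `&` x <= b) = (x <= lifetime_imp a b).
Proof.
rewrite !le_lifetimeE /= le_max ge_min.
by case: (b.1 <= a.1); case: (a.2 <= b.2); rewrite /= ?le0x ?lex1.
Qed.

Lemma lifetime_heyting : heyting_algebra (lifetime e1 e2).
Proof.
move=> a b; exists (lifetime_imp a b).
by split=> [|y]; rewrite le_lifetime_imp.
Qed.

End LifetimeCompleteness.

Theorem proposition3p1 (R : realType) (eps1 eps2 : {posnum R}) :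
  (forall (I : Type) (a : I -> lifetime eps1 eps2),
      infimums (range a) (lifetime_inf a) /\
      supremums (range a) (lifetime_sup a)) /\
  complete_lattice (lifetime eps1 eps2) /\
  (forall (I : Type) (x : lifetime eps1 eps2) (y : I -> lifetime eps1 eps2),
      x `&` lifetime_sup y = lifetime_sup (fun i : I => x `&` y i)) /\
  complete_heyting_algebra (lifetime eps1 eps2).
Proof.
split; first by move=> I a; split; [exact: lifetime_infP|exact: lifetime_supP].
split; first exact: lifetime_complete.
split; last by split; [exact: lifetime_heyting|exact: lifetime_complete].
move=> I x y.
exact: (meet_supremums _ le_lifetime_imp _ _ _ _ _
  (lifetime_supP _ _) (lifetime_supP _ _)).
Qed.
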